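(* Let $R$ be a ring with unity. The following are equivalent: (i) $R$ is semisimple. (ii) Every $R$-module is trace up to isomorphism in its injective envelope. (iii) Every $R$-module is quasi-injective.
   Context: $R$ is not necessarily commutative; modules are left modules. For $R$-modules $M,X$, the trace module of $M$ in $X$ is $\tau_M(X)=\sum_{\alpha\in\operatorname{Hom}_R(M,X)}\alpha(M)\subseteq X$. A submodule $M\subseteq X$ is a trace submodule of $X$ if $M=\tau_N(X)$ for some $R$-module $N$. $M$ is trace in $X$ up to isomorphism if there exists an injective $R$-homomorphism $\iota:M\to X$ such that $\operatorname{Im}(\iota)$ is a trace submodule of $X$. An $R$-module $M$ is quasi-injective if for any submodule $L\subseteq M$, every homomorphism $L\to M$ extends to an endomorphism of $M$. *)

(* Defs.v *)
From HB Require Import structures.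
From mathcomp Require Import all_boot all_order all_algebra.
From mathcomp Require Import boolp classical_sets.
Set Implicit Arguments.
Unset Strict Implicit.
Unset Printing Implicit Defensive.
Import GRing.Theory.
Local Open Scope classical_set_scope.
Local Open Scope ring_scope.

(* [pzRingType] is an arbitrary unital ring, the zero ring included. *)

Definition submodule (R : pzRingType) (X : lmodType R) (S : set X) : Prop :=
  submod_closed (mem S).

(* For submodules [F i], the finite sums of elements of the [F i]; an empty
   family has sum 0. *)
Definition submod_sum (R : pzRingType) (X : lmodType R) (I : Type)
    (D : set I) (F : I -> set X) : set X :=
  [set x | exists2 s : seq X, {subset s <= \bigcup_(i in D) F i} &
                              x = \sum_(y <- s) y].

Definition trace_module (R : pzRingType) (M X : lmodType R) : set X :=
  submod_sum [set: {linear M -> X}] (fun alpha => range alpha).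
Arguments trace_module {R} M X _.

Definition trace_submodule (R : pzRingType) (X : lmodType R) (S : set X) :
    Prop :=
  exists N : lmodType R, S = trace_module N X.

Definition trace_up_to_iso (R : pzRingType) (M X : lmodType R) : Prop :=
  exists2 iota : {linear M -> X}, injective iota & trace_submodule (range iota).

(* [L] ranges over the module structures carried by submodules [S] of [M];
   [val] is the inclusion of [L] in [M]. *)
Definition quasi_injective (R : pzRingType) (M : lmodType R) : Prop :=
  forall (S : {pred M}) (L : subLmodType S) (f : {linear L -> M}),
  exists g : {linear M -> M}, forall x : L, g (val x) = f x.

Definition injective_module (R : pzRingType) (E : lmodType R) : Prop :=
  forall (A B : lmodType R) (i : {linear A -> B}) (f : {linear A -> E}),
    injective i -> exists g : {linear B -> E}, forall a : A, g (i a) = f a.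

Definition essential (R : pzRingType) (E : lmodType R) (S : set E) : Prop :=
  forall T : set E, submodule T -> T `&` S `<=` [set 0] -> T `<=` [set 0].

Definition injective_envelope (R : pzRingType) (M E : lmodType R)
    (j : {linear M -> E}) : Prop :=
  [/\ injective_module E, injective j & essential (range j)].

(* An injective envelope of [M] is unique only up to isomorphism over [M], so
   the property is required of every one of them. *)
Definition trace_in_injective_envelope (R : pzRingType) (M : lmodType R) :
    Prop :=
  forall (E : lmodType R) (j : {linear M -> E}),
    injective_envelope j -> trace_up_to_iso M E.

Definition simple_submodule (R : pzRingType) (X : lmodType R) (S : set X) :
    Prop :=
  [/\ submodule S, S <> [set 0] &
      forall T : set X, submodule T -> T `<=` S -> T = [set 0] \/ T = S].

Definition direct_sum_decomposition (R : pzRingType) (X : lmodType R)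
    (I : Type) (F : I -> set X) : Prop :=
  submod_sum setT F = setT /\
  forall i : I, F i `&` submod_sum [set k | k <> i] F `<=` [set 0].

Definition semisimple_module (R : pzRingType) (X : lmodType R) : Prop :=
  exists (I : Type) (F : I -> set X),
    (forall i : I, simple_submodule (F i)) /\ direct_sum_decomposition F.

(* [R^o] is [R] as a left module over itself. *)
Definition semisimple_ring (R : pzRingType) : Prop := semisimple_module R^o.

(* Main.v *)
(* (i) => (ii): let [j : M -> E] be an injective envelope.  Writing [1] as a sum
   of elements of simple left ideals shows that [E] is a sum of simple
   submodules; each of them meets, hence lies in, the essential submodule
   [j M], so [j M = E], which is its own trace.
   (ii) => (iii): a trace submodule of [E] is stable under the endomorphisms of
   [E].  If [E] is injective, a map from a submodule of [M] to [M] extends to an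
   endomorphism of [E], which then restricts to the copy of [M] in [E].  An
   injective envelope exists: [M] embeds into a module of additive maps from
   [R] to a power of the divisible group of nonzero algebraic numbers, and two
   successive complements in an injective module cut out the envelope.
   (iii) => (i): quasi-injectivity of [S * X], for [S] a submodule of [X], gives
   a retraction of [X] onto [S].  When every submodule of [X] is a direct
   summand, a maximal independent family of simple submodules spans [X]. *)
Require Import Defs.
From HB Require Import structures.
From mathcomp Require Import all_boot all_order all_algebra all_field.
From mathcomp Require Import boolp classical_sets.
Set Implicit Arguments.
Unset Strict Implicit.
Unset Printing Implicit Defensive.
Import GRing.Theory Num.Theory.
Local Open Scope classical_set_scope.
Local Open Scope ring_scope.

(** * Submodules *)

Lemma submoduleP (R : pzRingType) (X : lmodType R) (S : set X) :
  submodule S <->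
  S 0 /\ forall a u v, S u -> S v -> S (a *: u + v).
Proof.
split=> [[S0 SD]|[S0 SD]]; split; first exact: set_mem.
- by move=> a u v Su Sv; apply: set_mem; apply: SD; exact: mem_set.
- exact: mem_set.
- by move=> a u v Su Sv; apply: mem_set; apply: SD; exact: set_mem.
Qed.

Section SubmoduleTheory.
Variables (R : pzRingType) (X : lmodType R) (S : set X).
Hypothesis hS : submodule S.

Lemma submodule0 : S 0.
Proof. by have /submoduleP[] := hS. Qed.

Lemma submoduleZ a u : S u -> S (a *: u).
Proof.
have /submoduleP[S0 SD] := hS => Su.
by rewrite -[a *: u]addr0; exact: SD.
Qed.

Lemma submoduleD u v : S u -> S v -> S (u + v).
Proof.
have /submoduleP[_ SD] := hS => Su Sv.
by rewrite -[u]scale1r; exact: SD.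
Qed.

Lemma submoduleB u v : S u -> S v -> S (u - v).
Proof.
by move=> Su Sv; apply: submoduleD => //; rewrite -scaleN1r; exact: submoduleZ.
Qed.

(** The term carries the proof of closure, where instance inference finds it. *)
Definition submodule_pred (_ : submodule S) : {pred X} := fun x => x \in S.

Lemma submodule_pred_closed : submod_closed (submodule_pred hS).
Proof. exact: hS. Qed.

HB.instance Definition _ :=
  GRing.isSubmodClosed.Build R X (submodule_pred hS) submodule_pred_closed.

Definition submodule_type := {x : X | submodule_pred hS x}.

HB.instance Definition _ := SubChoice.on submodule_type.
HB.instance Definition _ := [SubChoice_isSubLmodule of submodule_type by <:].

Lemma submodule_typeP (y : submodule_type) : S (val y).
Proof. exact: set_mem (valP y). Qed.

Lemma submodule_type_lift x : S x -> exists y : submodule_type, val y = x.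
Proof. by move=> /mem_set Sx; exists (exist _ x Sx). Qed.

End SubmoduleTheory.

Lemma linear_exists (R : pzRingType) (U V : lmodType R) (f : U -> V) :
  linear f -> exists g : {linear U -> V}, g =1 f.
Proof.
move=> hf.
pose fL := GRing.isLinear.Build R U V *:%R f hf.
pose g : {linear U -> V} := HB.pack f fL.
by exists g.
Qed.

(** Preimages under the injective [iota] are unique, so choosing them is linear. With [val] for
    [iota] this corestricts a map to a submodule. *)
Lemma linear_factor (R : pzRingType) (U V W : lmodType R)
    (iota : {linear V -> W}) (f : {linear U -> W}) :
  injective iota -> range f `<=` range iota ->
  exists g : {linear U -> V}, forall u, iota (g u) = f u.
Proof.
move=> inj_iota fR.
have /choice[g gE] u : exists v, iota v = f u.
  by have [|v _ <-] := fR (f u); [exists u | exists v].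
have g_lin : linear g.
  by move=> a u v; apply: inj_iota; rewrite linearP !gE linearP.
by have [h hE] := linear_exists g_lin; exists h => u; rewrite hE.
Qed.

Lemma submodule_range (R : pzRingType) (U V : lmodType R)
    (f : {linear U -> V}) : submodule (range f).
Proof.
apply/submoduleP; split; first by exists 0; rewrite ?linear0.
by move=> a _ _ [u _ <-] [v _ <-]; exists (a *: u + v); rewrite ?linearP.
Qed.

Lemma submodule_preimage (R : pzRingType) (U V : lmodType R)
    (f : {linear U -> V}) (S : set V) :
  submodule S -> submodule (f @^-1` S).
Proof.
move=> hS; apply/submoduleP; split; first by rewrite /= linear0; exact: submodule0.
move=> a u v /= Su Sv; rewrite linearP.
by apply: submoduleD => //; exact: submoduleZ.
Qed.

Lemma submodule_setI (R : pzRingType) (X : lmodType R) (A B : set X) :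
  submodule A -> submodule B -> submodule (A `&` B).
Proof.
move=> /submoduleP[A0 AD] /submoduleP[B0 BD]; apply/submoduleP; split=> //.
by move=> a u v [Au Bu] [Av Bv]; split; [exact: AD | exact: BD].
Qed.

Definition addset (X : zmodType) (A B : set X) : set X :=
  [set x | exists2 a, A a & exists2 b, B b & x = a + b].

Lemma submodule_addset (R : pzRingType) (X : lmodType R) (A B : set X) :
  submodule A -> submodule B -> submodule (addset A B).
Proof.
move=> /submoduleP[A0 AD] /submoduleP[B0 BD]; apply/submoduleP; split.
  by exists 0 => //; exists 0 => //; rewrite addr0.
move=> a _ _ [u Au [v Bv ->]] [u' Au' [v' Bv' ->]].
exists (a *: u + u'); first exact: AD.
by exists (a *: v + v'); [exact: BD | rewrite scalerDr addrACA].
Qed.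

Lemma subset_addsetl (R : pzRingType) (X : lmodType R) (A B : set X) :
  submodule B -> A `<=` addset A B.
Proof.
move=> hB a Aa; exists a => //.
by exists 0; [exact: (submodule0 hB) | rewrite addr0].
Qed.

Lemma subset_addsetr (R : pzRingType) (X : lmodType R) (A B : set X) :
  submodule A -> B `<=` addset A B.
Proof.
move=> hA b Bb; exists 0; first exact: (submodule0 hA).
by exists b => //; rewrite add0r.
Qed.

(** Taking for [W] a preimage or a sum of two submodules reduces a claim about a whole sum to its
    generators. *)
Lemma submod_sum_sub (R : pzRingType) (X : lmodType R) (I : Type) (D : set I)
    (F : I -> set X) (W : set X) :
  submodule W -> (forall i, D i -> F i `<=` W) -> submod_sum D F `<=` W.
Proof.
move=> hW FW _ [s sF ->]; elim: s sF => [|y s IH] sF.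
  by rewrite big_nil; exact: (submodule0 hW).
rewrite big_cons; apply: (submoduleD hW).
  have /set_mem[i Di Fy] := sF y (mem_head _ _).
  exact: FW Fy.
by apply: IH => z zs; apply: sF; rewrite inE zs orbT.
Qed.

Lemma sub_submod_sum (R : pzRingType) (X : lmodType R) (I : Type) (D : set I)
    (F : I -> set X) (i : I) : D i -> F i `<=` submod_sum D F.
Proof.
move=> Di y Fy; exists [:: y]; last by rewrite big_seq1.
by move=> z; rewrite inE => /eqP ->; apply/mem_set; exists i.
Qed.

Lemma submodule_submod_sum (R : pzRingType) (X : lmodType R) (I : Type)
    (D : set I) (F : I -> set X) :
  (forall i, D i -> submodule (F i)) -> submodule (submod_sum D F).
Proof.
move=> hF; apply/submoduleP; split; first by exists [::]; rewrite ?big_nil.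
move=> a _ _ [s sF ->] [t tF ->].
exists ([seq a *: y | y <- s] ++ t); last first.
  by rewrite big_cat big_map scaler_sumr.
move=> z; rewrite mem_cat => /orP[/mapP[y /sF/set_mem[i Di Fy] ->]|/tF //].
by apply/mem_set; exists i => //; exact: (submoduleZ (hF i Di)).
Qed.

(** [B] is an arbitrary set: a singleton serves to avoid one vector, a submodule to build
    complements. *)
Lemma maximal_submodule (R : pzRingType) (X : lmodType R) (N B : set X) :
  submodule N -> N `&` B `<=` [set 0] ->
  exists H : set X,
    [/\ submodule H, N `<=` H, H `&` B `<=` [set 0] &
      forall H', submodule H' -> H `<=` H' -> H' `&` B `<=` [set 0] ->
        H' `<=` H].
Proof.
(* The empty set is admitted only because [Zorn_bigcup] also asks for the union
   of the empty chain. *)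
move=> hN NB.
pose P (H : set X) := [/\ submodule H, N `<=` H & H `&` B `<=` [set 0]].
have [|H [HP maxH]] := @Zorn_bigcup X [set H | H = set0 \/ P H].
  move=> F FP Ftot.
  have memF H u : F H -> H u -> P H.
    by move=> /FP[->|//] Hu; case: Hu.
  have [[H0 [FH0 [u0 Hu0]]]|noH] := pselect (exists H, F H /\ H !=set0); last first.
    left; apply/seteqP; split=> // x [H FH Hx]; apply: noH.
    by exists H; split=> //; exists x.
  have [hH0 NH0 _] := memF _ _ FH0 Hu0.
  right; split.
  - apply/submoduleP; split; first by exists H0 => //; exact: submodule0.
    move=> a u v [H1 FH1 Hu] [H2 FH2 Hv].
    have [h1 _ _] := memF _ _ FH1 Hu; have [h2 _ _] := memF _ _ FH2 Hv.
    have [H12|H21] := Ftot _ _ FH1 FH2.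
      exists H2 => //; apply: (submoduleD h2) => //.
      by apply: (submoduleZ h2); exact: H12.
    exists H1 => //; apply: (submoduleD h1); last exact: H21.
    exact: (submoduleZ h1).
  - by move=> x /NH0 Hx; exists H0.
  - by move=> x [[H FH Hx] Bx]; have [_ _ HB] := memF _ _ FH Hx; apply: HB.
have {HP} [hH NH HB] : P H.
  case: HP => // H0; exfalso; apply: (maxH N); last by right; split.
  rewrite H0; split=> // N0; apply: (N0 0); exact: (submodule0 hN).
exists H; split=> // H' hH' HH' H'B; apply: contrapT => H'H.
by apply: (maxH H'); [split | right; split=> // x /NH/HH'].
Qed.

(** * Traces in injective modules *)

Lemma semisimple_ring_trace (R : pzRingType) :
  semisimple_ring R -> forall M : lmodType R, trace_in_injective_envelope M.
Proof.
move=> [I [F [Fsimple [Fsum _]]]] M E j [_ inj_j ess].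
have mul_lin (x : E) : linear (fun r : R^o => (r : R) *: x).
  by move=> a u v; rewrite /= scalerDl -scalerA.
have jT x : range j x.
  (* With [g] the map r -> r x, the left ideal of all r with r x in [range j] has to contain 1; it
     suffices that it contains every [F i]. *)
  have [g gE] := linear_exists (mul_lin x).
  have h1 : submod_sum setT F (1 : R) by rewrite Fsum.
  have hJ : submodule (g @^-1` range j).
    by apply: submodule_preimage; exact: submodule_range.
  suff: (g @^-1` range j) (1 : R) by rewrite /= gE scale1r.
  apply: (submod_sum_sub hJ _ h1) => i _.
  have [hF F0 Fmin] := Fsimple i.
  have [Fj0|FjF] := Fmin _ (submodule_setI hF hJ) (fun y => @proj1 _ _); last first.
    by rewrite -FjF => y [].
  (* Here [F i] meets that ideal in 0, so its image under [g] meets [range j] in 0 and vanishes by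
     essentiality. *)
  have hT : submodule (g @` F i).
    apply/submoduleP; split.
      by exists 0; [exact: (submodule0 hF) | rewrite linear0].
    move=> a _ _ [u Fu <-] [v Fv <-]; exists (a *: u + v); last by rewrite linearP.
    by apply: (submoduleD hF) => //; exact: (submoduleZ hF).
  have Tj : g @` F i `&` range j `<=` [set 0].
    move=> _ [[y Fy <-] jy].
    have : (F i `&` g @^-1` range j) y by split.
    by rewrite Fj0 => ->; rewrite /= linear0.
  move=> y Fy; have /= -> : g y = 0 by apply: (ess _ hT Tj); exists y.
  by exists 0; rewrite ?linear0.
(* The identity map shows that the trace of [E] in itself is all of [E]. *)
exists j => //; exists E; apply/seteqP; split=> [x _|x _]; last exact: jT.
have [g gE] := linear_exists (fun a => fun u v : E => erefl (a *: u + v)).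
by apply: (@sub_submod_sum _ _ _ _ _ g) => //; exists x.
Qed.

(** Composing a map from [N] with [g] gives another map from [N], so generators of the trace go to
    generators. *)
Lemma trace_module_invariant (R : pzRingType) (N E : lmodType R)
    (g : {linear E -> E}) (x : E) :
  trace_module N E x -> trace_module N E (g x).
Proof.
have hT : submodule (trace_module N E).
  by apply: submodule_submod_sum => alpha _; exact: submodule_range.
have hW := submodule_preimage g hT.
apply: (submod_sum_sub hW) => alpha _ _ [n _ <-] /=.
have h_lin : linear (fun n => g (alpha n)) by move=> a u v; rewrite !linearP.
have [h hE] := linear_exists h_lin.
by apply: (@sub_submod_sum _ _ _ _ _ h) => //; exists n => //; rewrite hE.
Qed.

Lemma trace_quasi_injective (R : pzRingType) (M E : lmodType R) :
  injective_module E -> trace_up_to_iso M E -> quasi_injective M.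
Proof.
move=> injE [iota inj_iota [N iotaN]] S L f.
have if_lin : linear (fun x : L => iota (f x)) by move=> a u v; rewrite !linearP.
have iv_lin : linear (fun x : L => iota (val x)) by move=> a u v; rewrite !linearP.
have [f' f'E] := linear_exists if_lin; have [i iE] := linear_exists iv_lin.
have inj_i : injective i by move=> u v; rewrite !iE => /inj_iota/val_inj.
have [g gE] := injE _ _ i f' inj_i.
have gi_lin : linear (fun x => g (iota x)) by move=> a u v; rewrite !linearP.
have [gi giE] := linear_exists gi_lin.
(* [g] preserves [range iota], a trace submodule, so its restriction pulls back to an endomorphism
   of [M]. *)
have [|h hE] := @linear_factor _ _ _ _ iota gi inj_iota.
  move=> _ [m _ <-]; rewrite giE iotaN; apply: trace_module_invariant.
  by rewrite -iotaN; exists m.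
by exists h => x; apply: inj_iota; rewrite hE giE -iE gE f'E.
Qed.

(** * Semisimplicity from retractions *)

(** A direct summand is recorded by a projection onto it, whose kernel is a complement. *)
Definition complemented (R : pzRingType) (X : lmodType R) : Prop :=
  forall S : set X, submodule S ->
  exists p : {linear X -> X}, range p `<=` S /\ forall x, S x -> p x = x.

(** In [T * X], with [T] a copy of [S], the map (0, s) -> (s, 0) extends to an endomorphism [g]. The
    first coordinate of g (0, x) is then the retraction. *)
Lemma quasi_injective_complemented (R : pzRingType) (X : lmodType R) :
  (forall M : lmodType R, quasi_injective M) -> complemented X.
Proof.
move=> qi S hS; pose T : lmodType R := submodule_type hS.
have valS (t : T) : S (val t) := submodule_typeP t.
have TS x : S x -> range (val : T -> X) x.
  by move=> /(submodule_type_lift hS)[y yx]; exists y.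
pose D : set (T * X) := [set u | u.1 = 0 /\ S u.2].
have hD : submodule D.
  apply/submoduleP; split; first by split=> //; exact: (submodule0 hS).
  move=> a [u1 u2] [v1 v2] [/= -> Su] [/= -> Sv]; split => /=.
    by rewrite scaler0 addr0.
  by apply: (submoduleD hS) => //; exact: (submoduleZ hS).
pose L : lmodType R := submodule_type hD.
have s_lin : linear (fun u : L => (val u).2) by move=> a u v; rewrite linearP.
have [s sE] := linear_exists s_lin.
have [|k kE] := @linear_factor _ L T X val s val_inj.
  by move=> _ [u _ <-]; rewrite sE; apply: TS; have /set_mem[] := valP u.
have f_lin : linear (fun u : L => (k u, 0) : T * X).
  by move=> a u v; rewrite linearP; congr pair; rewrite /= scaler0 addr0.
have [f fE] := linear_exists f_lin.
have [g gE] := qi (T * X)%type _ (submodule_type hD) f.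
have p_lin : linear (fun x => val (g (0 : T, x)).1 : X).
  move=> a u v; rewrite -linearP; congr val.
  have -> : (0 : T, a *: u + v) = a *: (0 : T, u) + (0 : T, v).
    by congr pair; rewrite /= scaler0 addr0.
  by rewrite linearP.
have [p pE] := linear_exists p_lin.
exists p; split; first by move=> _ [x _ <-]; rewrite pE.
move=> x Sx; have [u uE] : exists u : submodule_type hD, val u = (0 : T, x).
  exact: submodule_type_lift.
have := gE u.
by rewrite pE uE => ->; rewrite fE /=; apply: etrans (kE u) _; rewrite sE uE.
Qed.

(* A complement of a submodule maximal among those avoiding [x] is simple. *)
Lemma complemented_simple (R : pzRingType) (X : lmodType R) (S : set X) :
  complemented X -> submodule S -> S <> setT ->
  exists2 Q, simple_submodule Q & Q `&` S `<=` [set 0].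
Proof.
move=> cX hS SnT.
have [x Sx] : exists x, ~ S x.
  apply/not_existsP => Sx; apply: SnT; apply/seteqP; split=> // x _.
  exact: contrapT.
have [|P [hP SP Px maxP]] := @maximal_submodule _ _ S [set x] hS.
  by move=> y [Sy /= yx]; rewrite yx in Sy.
(* [x] is nonzero, being outside [S], so meeting [[set x]] only in 0 means not containing [x]. *)
have {}Px : ~ P x.
  move=> Px'; have /= x0 : [set 0] x by exact: Px.
  by apply: Sx; rewrite x0; exact: (submodule0 hS).
have {}maxP P' : submodule P' -> P `<=` P' -> ~ P' x -> P' `<=` P.
  by move=> hP' PP' P'x; apply: maxP => // y [P'y /= yx]; rewrite yx in P'y.
have [p [pP pid]] := cX P hP.
have {}pP y : P (p y) by apply: pP; exists y.
pose Q : set X := [set y | p y = 0].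
have hQ : submodule Q.
  apply/submoduleP; split; first exact: linear0.
  by move=> a u v Qu Qv; rewrite /Q /= linearP Qu Qv scaler0 addr0.
have PQ y : P y -> Q y -> y = 0 by move=> /pid py Qy; rewrite -py.
exists Q; last by move=> y [Qy /SP Py]; exact: PQ.
split=> // [Q0|T hT TQ].
  apply: Px; suff -> : x = p x by [].
  apply/eqP; rewrite -subr_eq0; apply/eqP.
  have : Q (x - p x) by rewrite /Q /= linearB (pid (p x)) // subrr.
  by rewrite Q0.
have [q [qT qid]] := cX T hT.
have {}qT y : T (q y) by apply: qT; exists y.
have [T0|Tn0] := pselect (T `<=` [set 0]).
  by left; apply/seteqP; split=> // _ ->; exact: (submodule0 hT).
have hPT := submodule_addset hP hT.
(* [P + T] properly contains [P], so by maximality it contains [x]. *)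
have [a Pa [t Tt xat]] : addset P T x.
  apply: contrapT => /(maxP _ hPT (subset_addsetl hT)) sub.
  apply: Tn0 => y Ty; apply: PQ; last exact: TQ.
  by apply: sub; exact: (subset_addsetr hP).
(* [U] is a complement of [T] in [Q]. If [x] were b + u as well as a + t, then t = u would lie in
   both [T] and [U], so t = 0 and [x] would be in [P]. *)
pose U : set X := Q `&` [set y | q y = 0].
have hU : submodule U.
  apply: submodule_setI => //; apply/submoduleP; split; first exact: linear0.
  by move=> b u v /= qu qv; rewrite linearP qu qv scaler0 addr0.
have hPU := submodule_addset hP hU.
have nPU : ~ addset P U x.
  move=> [b Pb [u [Qu qu] xbu]].
  have tu : t - u = 0.
    apply: PQ; last by apply: (submoduleB hQ) => //; exact: TQ.
    suff -> : t - u = b - a by exact: (submoduleB hP).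
    apply/eqP; rewrite subr_eq addrAC -xbu xat.
    by rewrite [a + t]addrC addrK.
  move: tu => /eqP; rewrite subr_eq0 => /eqP tu.
  apply: Px; suff t0 : t = 0 by rewrite xat t0 addr0.
  by rewrite -(qid _ Tt) tu.
right; apply/seteqP; split=> // y Qy.
(* By maximality [P + U] is inside [P], so [U] is 0 and [q] is the identity on [Q]. *)
have : y - q y = 0.
  have Uy : U (y - q y).
    split; first by apply: (submoduleB hQ) => //; exact: TQ.
    by rewrite /= linearB (qid (q y)) // subrr.
  apply: PQ; last by case: Uy.
  apply: (maxP _ hPU (subset_addsetl hU) nPU).
  exact: (subset_addsetr hP).
by move=> /eqP; rewrite subr_eq0 => /eqP ->.
Qed.

(** With a set of submodules instead of an indexed family, inclusion orders the candidates for
    Zorn's lemma. *)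
Definition independent (R : pzRingType) (X : lmodType R) (D : set (set X)) :
    Prop :=
  forall S, D S -> S `&` submod_sum (D `\ S) id `<=` [set 0].

(** A sum has finitely many terms, so one member of the chain already contains [S] and the
    submodules of all the terms. *)
Lemma independent_bigcup (R : pzRingType) (X : lmodType R)
    (F : set (set (set X))) :
  F `<=` @independent R X -> total_on F subset ->
  independent (\bigcup_(D in F) D).
Proof.
move=> Find Ftot S [D0 FD0 D0S] y [Sy [s sF ys]].
have [D [FD DS sD]] : exists D, [/\ F D, D S &
    {subset s <= \bigcup_(T in D `\ S) T}].
  elim: s sF {Sy ys} => [|z s IH] sF; first by exists D0.
  have [z' z's|D1 [FD1 D1S sD1]] := IH; first by apply: sF; rewrite inE z's orbT.
  have /set_mem[T [[D2 FD2 D2T] TS] Tz] := sF z (mem_head _ _).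
  have [D12|D21] := Ftot _ _ FD1 FD2.
    exists D2; split=> //; first exact: D12.
    move=> w; rewrite inE => /orP[/eqP ->|/sD1/set_mem[T' [D1T' T'S] T'w]].
      by apply/mem_set; exists T.
    by apply/mem_set; exists T' => //; split=> //; exact: D12.
  exists D1; split=> // w; rewrite inE => /orP[/eqP ->|/sD1 //].
  by apply/mem_set; exists T => //; split=> //; exact: D21.
by apply: (Find _ FD _ DS); split=> //; exists s.
Qed.

(** If y in S is t + q, with t a sum over the other members of [D] and q in [Q], then q = y - t lies
    in the sum of [D]. Hence q = 0, and independence of [D] gives y = 0. *)
Lemma independent_setU1 (R : pzRingType) (X : lmodType R) (D : set (set X))
    (Q : set X) :
  (forall S, D S -> submodule S) -> submodule Q -> independent D ->
  Q `&` submod_sum D id `<=` [set 0] -> independent (D `|` [set Q]).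
Proof.
move=> hD hQ Dind QD.
have hsum := submodule_submod_sum (F := id) hD.
have main S : D S -> S <> Q ->
    S `&` submod_sum ((D `|` [set Q]) `\ S) id `<=` [set 0].
  move=> DS SQ y [Sy yS].
  have hDS : submodule (submod_sum (D `\ S) id).
    by apply: submodule_submod_sum => T [/hD].
  have [t tS [q Qq ytq]] :
      addset (submod_sum (D `\ S) id) Q y.
    apply: (submod_sum_sub (submodule_addset hDS hQ) _ yS) => T [[DT|->] TS].
      apply: (subset_trans _ (subset_addsetl hQ)).
      by apply: (@sub_submod_sum _ _ _ (D `\ S) id).
    exact: subset_addsetr.
  have tD : submod_sum D id t.
    apply: (submod_sum_sub hsum _ tS) => T [DT _].
    exact: (@sub_submod_sum _ _ _ D id).
  have q0 : q = 0.
    apply: QD; split=> //.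
    have -> : q = y - t by rewrite ytq addrAC subrr add0r.
    by apply: (submoduleB hsum) => //; exact: (@sub_submod_sum _ _ _ D id _ DS).
  by apply: (Dind _ DS); split=> //; rewrite ytq q0 addr0.
move=> S; have [->|SQ] := pselect (S = Q); last first.
  by move=> [DS|/SQ //]; exact: main.
move=> _ y [Qy yQ]; apply: QD; split=> //.
apply: (submod_sum_sub hsum _ yQ) => T [[DT|->] TQ]; last by case: TQ.
exact: (@sub_submod_sum _ _ _ D id).
Qed.

Lemma complemented_semisimple (R : pzRingType) (X : lmodType R) :
  complemented X -> semisimple_module X.
Proof.
move=> cX.
have [|D [[Dsimple Dind] maxD]] := @Zorn_bigcup (set X)
    [set D | D `<=` @simple_submodule R X /\ independent D].
  move=> F FP Ftot; split; first by move=> S [D /FP[Ds _]]; exact: Ds.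
  by apply: independent_bigcup => // D /FP[].
have hD S : D S -> submodule S by case/Dsimple.
have Dsum : submod_sum D id = setT.
  apply: contrapT => DnT.
  have hsum := submodule_submod_sum (F := id) hD.
  have [Q Qs QD] := complemented_simple cX hsum DnT.
  have hQ : submodule Q by case: Qs.
  apply: (maxD (D `|` [set Q])).
    split; first by move=> S; left.
    (* [Q] is not in [D]: otherwise it would lie in the sum and be 0. *)
    move=> sub; case: Qs => _ Q0 _; apply: Q0; apply/seteqP; split.
      move=> y Qy; apply: QD; split=> //.
      by apply: (@sub_submod_sum _ _ _ D id Q) => //; apply: sub; right.
    by move=> _ ->; exact: (submodule0 hQ).
  by split; [move=> S [/Dsimple|->] | exact: independent_setU1].
(* By proof irrelevance, different indices give different submodules. *)
exists {S | D S}, (fun S => sval S); split; first by move=> [S DS]; exact: Dsimple.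
split.
  apply/seteqP; split=> // y _; have : submod_sum D id y by rewrite Dsum.
  apply: submod_sum_sub.
    by apply: submodule_submod_sum => -[S DS] _; exact: hD.
  by move=> S DS; exact: (@sub_submod_sum _ _ _ setT sval (exist _ S DS)).
move=> [S DS] y [/= Sy yS]; apply: (Dind _ DS); split=> //.
apply: (submod_sum_sub _ _ yS).
  by apply: submodule_submod_sum => T [/hD].
move=> [T DT] /= TS; apply: (@sub_submod_sum _ _ _ (D `\ S) id T).
split=> // TS'; apply: TS.
by apply: eq_exist.
Qed.

(** * Characters of abelian groups *)

(** The group of nonzero algebraic numbers is divisible with torsion of every order; it takes the
    place usually held by Q/Z. *)
Definition character (B : zmodType) (chi : B -> algC) : Prop :=
  (forall x, chi x != 0) /\ {morph chi : x y / x + y >-> x * y}.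

Lemma character0 (B : zmodType) (chi : B -> algC) : character chi -> chi 0 = 1.
Proof.
move=> [chi0 chiD]; apply: (mulfI (chi0 0)).
by rewrite -chiD addr0 mulr1.
Qed.

Lemma characterN (B : zmodType) (chi : B -> algC) x :
  character chi -> chi (- x) = (chi x)^-1.
Proof.
move=> h; have [chi0 chiD] := h; apply: (mulfI (chi0 x)).
by rewrite -chiD subrr character0 // divff.
Qed.

(* A partial character of [B] is represented by its graph in [B * algC]. *)
Definition partial_character (B : zmodType) (G : set (B * algC)) : Prop :=
  [/\ G (0, 1), forall u, G u -> u.2 != 0,
      forall u v, G u -> G v -> G (u.1 - v.1, u.2 / v.2) &
      forall c, G (0, c) -> c = 1].

Section PartialCharacter.
Variables (B : zmodType) (G : set (B * algC)).
Hypothesis hG : partial_character G.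

Lemma partial_characterV x c : G (x, c) -> G (- x, c^-1).
Proof.
case: hG => G1 _ GB _ Gx.
by have := GB _ _ G1 Gx; rewrite /= sub0r div1r.
Qed.

Lemma partial_characterM x c y d : G (x, c) -> G (y, d) -> G (x + y, c * d).
Proof.
case: hG => _ _ GB _ Gx /partial_characterV Gy.
by have := GB _ _ Gx Gy; rewrite /= opprK invrK.
Qed.

(** Quotients reduce single-valuedness to the case of the argument 0. *)
Lemma partial_character_uniq x c d : G (x, c) -> G (x, d) -> c = d.
Proof.
case: hG => _ G0 GB Gu Gx Gy.
have := Gu (c / d); rewrite -(subrr x) => /(_ (GB _ _ Gx Gy)) cd.
have /= d0 := G0 _ Gy.
by rewrite -[c](divfK d0) cd mul1r.
Qed.

Lemma partial_characterX x c (n : int) : G (x, c) -> G (x *~ n, c ^ n).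
Proof.
have nat_case m : G (x, c) -> G (x *+ m, c ^+ m).
  case: hG => G1 _ _ _ Gx; elim: m => [|m IH]; first by rewrite mulr0n expr0.
  by rewrite mulrSr exprSr; exact: partial_characterM.
case: n => m Gx; first by rewrite -pmulrn -exprnP; exact: nat_case.
by rewrite NegzE mulrNz -exprnN -pmulrn; apply: partial_characterV; exact: nat_case.
Qed.

(* If [d > 0] is least with [d x] in the domain, the value [c] at [x] has to be
   a [d]-th root of the value at [d x]; if there is no such [d], any [c] will
   do.  Outside the domain [d <> 1], hence [c <> 1] can be arranged. *)
Lemma partial_character_value x :
  (forall c, ~ G (x, c)) ->
  exists c : algC, [/\ c != 0, c != 1 &
    forall (n : int) u, G (x *~ n, u) -> u = c ^ n].
Proof.
move=> xG; have [G1 G0 GB Gu] := hG.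
pose P (d : nat) := `[< (0 < d)%N /\ exists u, G (x *+ d, u) >].
have [[d0 Pd0]|noP] := pselect (exists d, P d); last first.
  (* No nonzero multiple of [x] is in the domain; 2 is just a number other than 0 and 1. *)
  exists 2; split; [by rewrite pnatr_eq0 | by rewrite (eqr_nat _ 2 1) |].
  suff pos (m : nat) u : G (x *+ m, u) -> m = 0%N.
    case=> m u Gm.
      have m0 : m = 0%N by apply: (pos m u); rewrite pmulrn.
      by rewrite m0 expr0z; apply: Gu; move: Gm; rewrite m0 mulr0z.
    have := partial_characterV Gm.
    by rewrite NegzE mulrNz opprK -pmulrn => /pos.
  move=> Gm; apply/eqP; rewrite -leqn0 leqNgt; apply/negP => m0.
  by apply: noP; exists m; apply/asboolP; split=> //; exists u.
have [d /asboolP[d_gt0 [u Gd]] mind] := ex_minnP (ex_intro P d0 Pd0).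
have d_neq1 : d != 1%N by apply/eqP => d1; apply: (xG u); move: Gd; rewrite d1.
have d_gt1 : (1 < d)%N by rewrite ltn_neqAle eq_sym d_neq1.
have u0 : u != 0 := G0 _ Gd.
have [c cd c1] : exists2 c : algC, c ^+ d = u & c != 1.
  have [r1|r1] := eqVneq (d.-root u) 1; last first.
    by exists (d.-root u) => //; rewrite rootCK.
  (* Now [u] = 1, and a primitive [d]-th root of unity differs from 1 because [d] > 1. *)
  have [z z_prim] := C_prim_root_exists d_gt0.
  exists z; first by rewrite -(rootCK d_gt0 u) r1 expr1n (prim_expr_order z_prim).
  apply/eqP => z1; have := eq_prim_root_expr z_prim 0 1.
  by rewrite z1 !expr1n eqxx mod0n modn_small.
have c0 : c != 0.
  by apply: contraNneq u0 => c0; rewrite -cd c0 expr0n gtn_eqF.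
exists c; split=> // n w Gn.
(* The multiple of [x] by the remainder is in the domain, so minimality of [d] makes the remainder
   0. *)
pose q := (n %/ d)%Z; pose r := (n %% d)%Z.
have nE : n = q * d + r := divz_eq n d.
have r_ge0 : 0 <= r by rewrite modz_ge0 // -lt0n.
have r_lt : r < d by rewrite ltz_pmod.
have Gq : G (x *~ (q * d), u ^ q).
  by rewrite mulrC mulrzA -pmulrn; exact: partial_characterX.
have nr : n - q * d = r by rewrite {1}nE addrC addKr.
have := GB _ _ Gn Gq; rewrite /= -mulrzBr nr.
case: r r_ge0 r_lt nE {nr} => // m _ m_lt nE Gm.
have m0 : m = 0%N.
  apply/eqP; rewrite -leqn0 leqNgt; apply/negP => m0.
  have : (d <= m)%N.
    by apply: mind; apply/asboolP; split=> //; exists (w / u ^ q).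
  by rewrite leqNgt; move: m_lt; rewrite ltz_nat => ->.
move: Gm; rewrite m0 mulr0z => /Gu wq.
rewrite -[w](@divfK _ (u ^ q)) ?expfz_neq0 // wq mul1r nE m0 addr0.
by rewrite mulrC -exprz_exp -exprnP cd.
Qed.

(** The domain grows to the subgroup generated by it and [x]. The value at [x] is kept away from 1
    for the separation of points. *)
Lemma partial_character_step x :
  (forall c, ~ G (x, c)) ->
  exists G' : set (B * algC),
    [/\ partial_character G', G `<=` G' & exists2 c, c != 1 & G' (x, c)].
Proof.
move=> xG; have [c [c0 c1 cG]] := partial_character_value xG.
have [G1 G0 GB Gu] := hG.
exists [set u | exists (n : int) v, G v /\ u = (v.1 + x *~ n, v.2 * c ^ n)].
split.
- split.
  + by exists 0, (0, 1); split=> //=; rewrite mulr0z addr0 expr0z mulr1.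
  + by move=> _ [n [v [Gv ->]]] /=; rewrite mulf_neq0 ?expfz_neq0 ?G0.
  + move=> _ _ [n [v [Gv ->]]] [m [w [Gw ->]]] /=.
    exists (n - m), (v.1 - w.1, v.2 / w.2); split; first exact: GB.
    rewrite /= mulrzBr opprD addrACA; congr pair.
    by rewrite expfzDr // -invr_expz invfM mulrACA.
  (* If y + n x = 0, then [G] takes the value d^-1 at n x, which the choice of [c] makes c^n. *)
  + move=> _ [n [[y d] [Gv [/esym y0 ->]]]] /=.
    have yE : y = - (x *~ n) by apply/eqP; rewrite -addr_eq0 y0.
    have Gd := partial_characterV Gv; rewrite yE opprK in Gd.
    by rewrite -(cG _ _ Gd) divff // (G0 _ Gv).
- by move=> [y d] Gy; exists 0, (y, d); rewrite /= mulr0z addr0 expr0z mulr1.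
- by exists c => //; exists 1, (0, 1); split=> //=; rewrite add0r mulr1z mul1r expr1z.
Qed.

End PartialCharacter.

(** Zorn's lemma on graphs, the empty set again serving the empty chain; a maximal graph is total by
    [partial_character_step]. *)
Lemma partial_character_extend (B : zmodType) (G : set (B * algC)) :
  partial_character G ->
  exists chi : B -> algC,
    character chi /\ forall x c, G (x, c) -> chi x = c.
Proof.
move=> hG; have [|H [HP maxH]] := @Zorn_bigcup (B * algC)
    [set H | H = set0 \/ (partial_character H /\ G `<=` H)].
  move=> F FP Ftot.
  have memF H u : F H -> H u -> partial_character H /\ G `<=` H.
    by move=> /FP[->|//] Hu; case: Hu.
  have [[H0 [FH0 [u0 Hu0]]]|noH] := pselect (exists H, F H /\ H !=set0); last first.
    left; apply/seteqP; split=> // u [H FH Hu]; apply: noH.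
    by exists H; split=> //; exists u.
  have [[H01 _ _ _] GH0] := memF _ _ FH0 Hu0.
  right; split; last by move=> u /GH0 Hu; exists H0.
  split; first by exists H0.
  - by move=> u [H FH Hu]; have [[_ h _ _] _] := memF _ _ FH Hu; exact: h.
  - move=> u v [H1 FH1 Hu] [H2 FH2 Hv].
    have [[_ _ h1 _] _] := memF _ _ FH1 Hu; have [[_ _ h2 _] _] := memF _ _ FH2 Hv.
    have [H12|H21] := Ftot _ _ FH1 FH2.
      by exists H2 => //; apply: h2 => //; exact: H12.
    by exists H1 => //; apply: h1 => //; exact: H21.
  - by move=> c [H FH Hc]; have [[_ _ _ h] _] := memF _ _ FH Hc; exact: h.
have {HP} [hH GH] : partial_character H /\ G `<=` H.
  case: HP => // H0; exfalso; apply: (maxH G); last by right; split.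
  by case: hG => G1 _ _ _; rewrite H0; split=> // G0; exact: (G0 _ G1).
have Htot x : exists c, H (x, c).
  apply: contrapT => /forallNP xH.
  have [H' [hH' HH' [c _ H'x]]] := partial_character_step hH xH.
  apply: (maxH H'); last by right; split=> // u /GH/HH'.
  by split=> // H'H; apply: (xH c); exact: H'H.
have [chi chiH] := choice Htot.
have [H1 H0 _ _] := hH.
exists chi; split; last by move=> x c /GH; exact: partial_character_uniq.
split=> [x|x y]; first exact: (H0 _ (chiH x)).
exact: (partial_character_uniq hH (chiH _) (partial_characterM hH _ _)).
Qed.

(** Injectivity of [i] makes the transported graph of [chi] single-valued. *)
Lemma character_extend (A B : zmodType) (i : {additive A -> B})
    (chi : A -> algC) :
  injective i -> character chi ->
  exists chi' : B -> algC, character chi' /\ forall a, chi' (i a) = chi a.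
Proof.
move=> inj_i hchi; have [chi0 chiD] := hchi.
have hG : partial_character [set u | exists a, u = (i a, chi a)].
  split.
  - by exists 0; rewrite raddf0 character0.
  - by move=> _ [a ->]; exact: chi0.
  - move=> _ _ [a ->] [b ->]; exists (a - b).
    by rewrite raddfB chiD characterN.
  - move=> c [a [ia ->]]; suff -> : a = 0 by exact: character0.
    by apply: inj_i; rewrite raddf0.
have [chi' [hchi' chi'G]] := partial_character_extend hG.
by exists chi'; split=> // a; apply: chi'G; exists a.
Qed.

(** One step from the trivial character of 0 already gives [x] a value other than 1. *)
Lemma character_separates (B : zmodType) (x : B) :
  x != 0 -> exists2 chi : B -> algC, character chi & chi x != 1.
Proof.
move=> x0.
have hG : partial_character [set (0 : B, 1 : algC)].
  split=> //.
  - by move=> _ ->; rewrite oner_neq0.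
  - by move=> _ _ -> ->; rewrite /= subrr divr1.
  - by move=> c [].
have [c [xc]|G [hG' _ [c c1 Gx]]] := @partial_character_step _ _ hG x.
  by move: x0; rewrite xc eqxx.
have [chi [hchi chiG]] := partial_character_extend hG'.
by exists chi => //; rewrite (chiG _ _ Gx).
Qed.

(** * Injective envelopes *)

Section CoinducedModule.
Variables (R : pzRingType) (I : Type).

(* The group homomorphisms from [R] to the [I]-th power of the unit group of
   [algC]. *)
Definition coinduced := {f : I -> R -> algC | forall i, character (f i)}.

Lemma coinduced_eq (f g : coinduced) :
  (forall i r, sval f i r = sval g i r) -> f = g.
Proof.
case: f g => [f hf] [g hg] /= fg; apply: eq_exist.
by apply/funext => i; apply/funext => r; exact: fg.
Qed.

HB.instance Definition _ := gen_eqMixin coinduced.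
HB.instance Definition _ := gen_choiceMixin coinduced.

Definition coinduced0 : coinduced.
Proof.
exists (fun _ _ => 1) => i; split=> [x|x y]; first exact: oner_neq0.
by rewrite mulr1.
Defined.

Definition coinducedN (f : coinduced) : coinduced.
Proof.
exists (fun i r => (sval f i r)^-1) => i; have [f0 fD] := svalP f i.
by split=> [x|x y]; rewrite ?invr_eq0 // fD invfM.
Defined.

Definition coinducedD (f g : coinduced) : coinduced.
Proof.
exists (fun i r => sval f i r * sval g i r) => i.
have [f0 fD] := svalP f i; have [g0 gD] := svalP g i.
by split=> [x|x y]; rewrite ?mulf_neq0 // fD gD mulrACA.
Defined.

(** Multiplying the argument on the right makes this a left action. *)
Definition coinducedZ (a : R) (f : coinduced) : coinduced.
Proof.
exists (fun i r => sval f i (r * a)) => i; have [f0 fD] := svalP f i.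
by split=> [x|x y] //; rewrite mulrDl fD.
Defined.

Lemma coinducedDA : associative coinducedD.
Proof. by move=> f g h; apply: coinduced_eq => i r /=; rewrite mulrA. Qed.

Lemma coinducedDC : commutative coinducedD.
Proof. by move=> f g; apply: coinduced_eq => i r /=; rewrite mulrC. Qed.

Lemma coinduced0D : left_id coinduced0 coinducedD.
Proof. by move=> f; apply: coinduced_eq => i r /=; rewrite mul1r. Qed.

Lemma coinducedND : left_inverse coinduced0 coinducedN coinducedD.
Proof.
move=> f; apply: coinduced_eq => i r /=; rewrite mulVf //.
by case: (svalP f i) => f0 _; exact: f0.
Qed.

HB.instance Definition _ := GRing.isZmodule.Build coinduced
  coinducedDA coinducedDC coinduced0D coinducedND.

Lemma coinducedZA a b (f : coinduced) :
  coinducedZ a (coinducedZ b f) = coinducedZ (a * b) f.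
Proof. by apply: coinduced_eq => i r /=; rewrite mulrA. Qed.

Lemma coinduced1Z : left_id 1 coinducedZ.
Proof. by move=> f; apply: coinduced_eq => i r /=; rewrite mulr1. Qed.

Lemma coinducedZDr : right_distributive coinducedZ +%R.
Proof. by move=> a f g; exact: coinduced_eq. Qed.

Lemma coinducedZDl (f : coinduced) : {morph coinducedZ^~ f : a b / a + b}.
Proof.
move=> a b; apply: coinduced_eq => i r /=; rewrite mulrDr.
by case: (svalP f i) => _; apply.
Qed.

HB.instance Definition _ := GRing.Zmodule_isLmodule.Build R coinduced
  coinducedZA coinduced1Z coinducedZDr coinducedZDl.

Lemma coinducedDE (f g : coinduced) i r :
  sval (f + g) i r = sval f i r * sval g i r.
Proof. by []. Qed.

Lemma coinducedZE a (f : coinduced) i r : sval (a *: f) i r = sval f i (r * a).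
Proof. by []. Qed.

(** Evaluation at 1 turns a linear map into a family of characters of [A]. These extend to [B], and
    b -> (r -> chi (r b)) turns them back into a linear map. *)
Lemma coinduced_injective : injective_module coinduced.
Proof.
move=> A B j f inj_j.
have char_f i : character (fun a => sval (f a) i 1).
  split=> [a|a b]; first by case: (svalP (f a) i).
  by rewrite linearD coinducedDE.
have /choice[chi chiP] i := character_extend inj_j (char_f i).
have g_char b i : character (fun r : R => chi i (r *: b)).
  have [[chi0 chiD] _] := chiP i.
  by split=> [r|r s] //; rewrite scalerDl chiD.
pose g b : coinduced := exist _ (fun i r => chi i (r *: b)) (g_char b).
have g_lin : linear g.
  move=> a u v; apply: coinduced_eq => i r.
  have [[_ chiD] _] := chiP i.
  by rewrite coinducedDE coinducedZE /= scalerDr chiD scalerA.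
have [h hE] := linear_exists g_lin; exists h => a; rewrite hE.
apply: coinduced_eq => i r /=; have [_ chiE] := chiP i.
by rewrite -linearZ chiE linearZ coinducedZE mul1r.
Qed.

End CoinducedModule.

(** The power is indexed by [M] itself: each nonzero m has its own character, nontrivial at m, which
    detects m when evaluated at r = 1. *)
Lemma enough_injectives (R : pzRingType) (M : lmodType R) :
  exists (E : lmodType R) (j : {linear M -> E}),
    injective_module E /\ injective j.
Proof.
have sep (m : M) : exists chi : M -> algC,
    character chi /\ (m != 0 -> chi m != 1).
  have [->|/character_separates[chi hchi chim]] := eqVneq m 0.
    exists (fun=> 1); split=> //.
    by split=> [x|x y]; rewrite ?oner_neq0 ?mulr1.
  by exists chi.
have [chi chiP] := choice sep.
have j_char (m : M) (i : M) : character (fun r : R => chi i (r *: m)).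
  have [[chi0 chiD] _] := chiP i.
  by split=> [r|r s] //; rewrite scalerDl chiD.
pose j m : coinduced R M := exist _ (fun i r => chi i (r *: m)) (j_char m).
have j_lin : linear j.
  move=> a u v; apply: coinduced_eq => i r.
  have [[_ chiD] _] := chiP i.
  by rewrite coinducedDE coinducedZE /= scalerDr chiD scalerA.
have [h hE] := linear_exists j_lin.
exists (coinduced R M), h; split; first exact: coinduced_injective.
move=> u v huv; apply/eqP; rewrite -subr_eq0; apply/negPn/negP => uv0.
have [chiC /(_ uv0) /eqP] := chiP (u - v); apply.
have h0 : h (u - v) = 0 by rewrite linearB huv subrr.
have : sval (h (u - v)) (u - v) 1 = 1 by rewrite h0.
by rewrite hE /= scale1r.
Qed.

Lemma injective_envelope_exists (R : pzRingType) (M : lmodType R) :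
  exists (E : lmodType R) (j : {linear M -> E}), injective_envelope j.
Proof.
have [E [j [injE inj_j]]] := enough_injectives M.
have hN := submodule_range j; set N := range j in hN.
have h0 : submodule [set (0 : E)].
  apply/submoduleP; split=> // a u v -> ->.
  by rewrite scaler0 addr0.
(* [K] is a complement of [N] and [H] one of [K] containing [N]: then [H] is
   an essential extension of [N] without proper essential extension. *)
have [|K [hK _ KN maxK]] := @maximal_submodule _ E [set 0] N h0.
  by move=> x [].
have [|H [hH NH HK maxH]] := @maximal_submodule _ E N K hN.
  by move=> x [Nx Kx]; apply: KN.
pose A : lmodType R := (submodule_type hH * submodule_type hK)%type.
have i_lin : linear (fun u : A => val u.1 + val u.2 : E).
  by move=> a u v; rewrite /= scalerDr addrACA.
have f_lin : linear (fun u : A => val u.1 : E) by [].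
have [i iE] := linear_exists i_lin; have [f fE] := linear_exists f_lin.
have memH (x : submodule_type hH) : H (val x) := submodule_typeP x.
have memK (x : submodule_type hK) : K (val x) := submodule_typeP x.
have inj_i : injective i.
  suff i0 u : i u = 0 -> u = 0 by exact: raddf_inj i0.
  case: u => [u1 u2]; rewrite iE /= => /eqP.
  rewrite addr_eq0 => /eqP u12; have {}u12 : val u1 = - val u2 := u12.
  have u10 : val u1 = 0.
    apply: HK; split=> //; rewrite u12 -[X in K X]sub0r.
    by apply: (submoduleB hK) => //; exact: (submodule0 hK).
  have u20 : val u2 = 0 by apply: oppr_inj; rewrite oppr0 -u12 u10.
  by congr pair; apply: val_inj; rewrite linear0.
(* [g] extends the projection of [H + K] onto [H] to all of [E]. *)
have [g gE] := injE _ _ i f inj_i.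
have gH x : H x -> g x = x.
  move=> /(submodule_type_lift hH)[y yE].
  by have := gE (y, 0); rewrite iE fE /= addr0 => gy; rewrite -yE.
have gK x : K x -> g x = 0.
  move=> /(submodule_type_lift hK)[y yE].
  by have := gE (0, y); rewrite iE fE /= add0r => gy; rewrite -yE.
have HgE : H `<=` range g by move=> x /gH <-; exists x.
(* By maximality of [H], it suffices that [range g] meets [K] in 0. The preimage of [K] under [g]
   contains [K] and meets [N] in 0, hence equals [K], which [g] kills. *)
have gER : range g `<=` H.
  apply: maxH => //; first exact: submodule_range.
  move=> _ [[x _ <-] Kgx]; apply: (gK _).
  apply: (maxK (g @^-1` K)) x Kgx; first exact: submodule_preimage.
    by move=> x /gK gx0; rewrite /= gx0; exact: (submodule0 hK).
  by move=> x [/= Kgx Nx]; apply: KN; split=> //; rewrite -(gH _ (NH _ Nx)).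
pose H' : lmodType R := submodule_type hH.
have valH x : H x -> range (val : H' -> E) x.
  by move=> /(submodule_type_lift hH)[y yE]; exists y.
have [|j' j'E] := @linear_factor _ M H' E val j val_inj.
  by move=> x Nx; apply/valH/NH.
exists H', j'; split.
(* [H] is injective as the image of the retraction [g] of [E]. *)
- move=> A' B i' f' inj_i'.
  have vf_lin : linear (fun a => val (f' a) : E) by move=> a u v; rewrite !linearP.
  have [vf vfE] := linear_exists vf_lin.
  have [e eE] := injE _ _ i' vf inj_i'.
  have ge_lin : linear (fun b => g (e b)) by move=> a u v; rewrite !linearP.
  have [ge geE] := linear_exists ge_lin.
  have [|h hE] := @linear_factor _ B H' E val ge val_inj.
    by move=> _ [b _ <-]; apply/valH/gER; rewrite geE; exists (e b).
  exists h => a; apply: val_inj; apply: etrans (hE _) _.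
  by rewrite geE eE vfE gH.
- by move=> u v uv; apply: inj_j; rewrite -!j'E uv.
- move=> T hT TN.
  have hT' : submodule ((val : H' -> E) @` T).
    apply/submoduleP; split.
      by exists 0; [exact: (submodule0 hT) | exact: linear0].
    move=> a _ _ [u Tu <-] [v Tv <-]; exists (a *: u + v); last exact: linearP.
    by apply: (submoduleD hT) => //; exact: (submoduleZ hT).
  (* [T + K] meets [N] in 0: if u + k is in [N], then k is in both [H] and [K], so k = 0 and u is in
     [T] and [N]. Maximality of [K] puts [T] inside [K], hence [T] is 0. *)
  move=> t Tt; apply: val_inj; apply: etrans (esym (linear0 _)).
  apply: (HK _); split; first exact: memH.
  apply: (maxK _ (submodule_addset hT' hK) (subset_addsetr hT')); last first.
    by apply: (subset_addsetl hK); exists t.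
  move=> _ [[_ [u Tu <-] [k Kk ->]] Nuk].
  have k0 : k = 0.
    apply: HK; split=> //; rewrite -(addKr (val u) k) addrC.
    by apply: (submoduleB hH); [exact: NH | exact: memH].
  move: Nuk; rewrite k0 addr0 => -[m _ jm].
  have u0 : u = 0.
    apply: TN; split=> //; exists m => //; apply: val_inj.
    exact: etrans (j'E m) jm.
  by rewrite u0; exact: linear0.
Qed.

Theorem theorem4p2 (R : pzRingType) :
  (semisimple_ring R <->
     (forall M : lmodType R, trace_in_injective_envelope M)) /\
  ((forall M : lmodType R, trace_in_injective_envelope M) <->
     (forall M : lmodType R, quasi_injective M)).
Proof.
have trace_qi : (forall M : lmodType R, trace_in_injective_envelope M) ->
    forall M : lmodType R, quasi_injective M.
  move=> tr M; have [E [j envj]] := injective_envelope_exists M.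
  by apply: (@trace_quasi_injective _ _ E); [case: envj | exact: tr envj].
have qi_ss : (forall M : lmodType R, quasi_injective M) -> semisimple_ring R.
  by move=> qi; apply: complemented_semisimple; exact: quasi_injective_complemented.
have ss_trace := @semisimple_ring_trace R.
by split; split; auto.
Qed.
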